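(* If $D$ is a virtual link diagram (oriented) and $C$ is any Euler system of the universe graph of $D$, then the marked-graph bracket polynomial $[\mathcal{L}(D,C)]$ is the same as the (three-variable) Kauffman bracket $[D]$.
   Context: A marked graph is a finite undirected graph $G$ without multiple edges, in which each vertex may be looped or unlooped, each vertex is either unmarked or carries one of the marks $r,c,cr,u,ur$, together with a number $\phi\ge 0$ of free loops (extra components with no vertices or edges). Marked-graph bracket: let $V(G)=\{v_1,\dots,v_n\}$. The Boolean adjacency matrix $\mathcal{A}(G)$ is the $n\times n$ matrix over $GF(2)$ with $(i,j)$ entry ($i\neq j$) equal to $1$ iff $v_i,v_j$ are adjacent, and $(i,i)$ entry equal to $1$ iff $v_i$ is looped. For $T\subseteq V(G)$, $\Delta_T$ is the diagonal matrix over $GF(2)$ whose $i$-th diagonal entry is $1$ iff either $v_i\in T$ and the mark of $v_i$ does not involve the letter $r$, or $v_i\notin T$ and the mark of $v_i$ involves $r$ (being unmarked counts as not involving $r$). $\mathcal{A}(G)_T$ is the submatrix of $\mathcal{A}(G)+\Delta_T$ obtained by removing the $i$-th row and column whenever either $v_i$ is marked $c$ or $cr$ and $(\mathcal{A}(G)+\Delta_T)_{ii}=0$, or $v_i$ is marked $u$ or $ur$ and $(\mathcal{A}(G)+\Delta_T)_{ii}=1$. Then $$[G]=d^{\phi}\sum_{T\subseteq V(G)}A^{n-|T|}B^{|T|}d^{\nu(\mathcal{A}(G)_T)}\in\mathbb{Z}[A,B,d],$$ where $\nu$ denotes $GF(2)$-nullity (the empty matrix has nullity $0$). An oriented (virtual)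 link diagram $D$ is a finite (nonempty) collection of oriented piecewise smooth closed curves in the plane whose only singularities are finitely many double points, each designated as a classical crossing (with over/under information, hence positive or negative) or a virtual crossing. The universe graph $U$ is the abstract $4$-regular graph (loops and multiple edges allowed) whose vertices are the classical crossings and whose edges are the arcs of $D$ joining classical crossings, passing through virtual crossings; $U$ also has one free loop (a component with no vertices or edges) for each link component having no classical crossing. $c(U)$ is the number of connected components of $U$, free loops included. An Euler system $C$ of $U$ is a set containing one Euler circuit (a closed walk traversing every edge exactly once; no preferred orientation or starting point) for each connected component of $U$ that has vertices. Two distinct vertices $v,w$ are interlaced with respect to $C$ if a circuit of $C$ encounters them in the cyclic order $v,w,v,w$. A transition at a vertex $v$ is a partition of the four incident half-edges into two pairs; there are three. With respect to $C$ (orient the incident circuit of $C$ in either way; the choice does not matter) they are: the one following $C$, denoted F; the one other than F that pairs incoming with outgoing half-edges, the orientation-consistent one, denoted N; and the orientation-inconsistent one, denoted I. With respect to $D$, two of the transitions are smoothings: the oriented smoothing (the one consistent with the link orientation that does not follow the strands through the crossing) and the unoriented smoothing (inconsistent with the link orientation). The mark of $v$ determined by $C$ is given by the pair (oriented smoothing, unoriented smoothing): unmarked if it is (N, I); $r$ if (I, N); $c$ if (F, I); $cr$ if (I, F); $u$ if (N, F); $ur$ if (F, N). The marked interlacement graph $\mathcal{L}(D,C)$ has as vertices the classical crossings of $D$, with these marks; a vertex is looped iff the crossing is negative; two distinct vertices are adjacent iff they are interlaced with respect to $C$; and it has $c(U)-1$ free loops. Kauffman bracket: at a positive crossing the $A$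 smoothing is the oriented smoothing and the $B$ smoothing is the unoriented one; at a negative crossing the two are interchanged. A Kauffman state $S$ is a choice of one smoothing at each classical crossing; $a(S),b(S)$ are the numbers of $A$ and $B$ smoothings in $S$ and $c(S)$ is the number of closed curves resulting from $S$ (link components without classical crossings included). Then $[D]=\sum_S A^{a(S)}B^{b(S)}d^{c(S)-1}$. *)

(* Defs.v *)
From HB Require Import structures.
From mathcomp Require Import all_boot all_order all_algebra.
From mathcomp Require mpoly.

Module Export PolynomialRing.
Import GRing.Theory mpoly.
Local Open Scope ring_scope.

Definition ZABd : comNzRingType := {mpoly int[3]}.
Definition polyA : ZABd := 'X_(inord 0) : {mpoly int[3]}.
Definition polyB : ZABd := 'X_(inord 1) : {mpoly int[3]}.
Definition polyd : ZABd := 'X_(inord 2) : {mpoly int[3]}.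

End PolynomialRing.

From mathcomp Require Import all_classical all_reals all_analysis.
From mathcomp Require Import lra.
Import Order.TTheory GRing.Theory Num.Theory.
Import numFieldNormedType.Exports.

Set Implicit Arguments.
Unset Strict Implicit.
Unset Printing Implicit Defensive.

Local Open Scope ring_scope.

Inductive mark := Unmarked | Mr | Mc | Mcr | Mu | Mur.

Definition has_r (m : mark) : bool :=
  match m with Mr | Mcr | Mur => true | _ => false end.
Definition has_c (m : mark) : bool :=
  match m with Mc | Mcr => true | _ => false end.
Definition has_u (m : mark) : bool :=
  match m with Mu | Mur => true | _ => false end.

Record marked_graph := MarkedGraph {
  order_of : nat;
  adjacent : rel 'I_order_of;
  adjacent_irr : irreflexive adjacent;
  adjacent_sym : symmetric adjacent;
  looped : pred 'I_order_of;
  mark_of : 'I_order_of -> mark;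
  free_loops : nat
}.

Section Bracket.
Variable G : marked_graph.
Local Notation n := (order_of G).

Definition adjmx : 'M['F_2]_n :=
  \matrix_(i, j) (if i == j then looped i else adjacent i j)%:R.

Definition delta_mark (T : {set 'I_n}) : 'M['F_2]_n :=
  diag_mx (\row_i (((i \in T) && ~~ has_r (mark_of i))
                   || ((i \notin T) && has_r (mark_of i)))%:R).

Definition kept (T : {set 'I_n}) : {set 'I_n} :=
  [set i | ~~ ((has_c (mark_of i) && ((adjmx + delta_mark T) i i == 0))
            || (has_u (mark_of i) && ((adjmx + delta_mark T) i i == 1)))].

Definition adjmx_at (T : {set 'I_n}) : 'M['F_2]_#|kept T| :=
  mxsub enum_val enum_val (adjmx + delta_mark T).

Definition nullity m (M : 'M['F_2]_m) : nat := (m - \rank M)%N.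

Definition bracket : ZABd :=
  polyd ^+ free_loops G *
  \sum_(T : {set 'I_n})
    polyA ^+ (n - #|T|) * polyB ^+ #|T| * polyd ^+ nullity (adjmx_at T).

End Bracket.

Definition alternate (T : eqType) (s : seq T) (v w : T) : bool :=
  [exists k : 'I_(size s), subseq [:: v; w; v; w] (rot k s)].

Lemma rot_rot_ord (T : Type) (s : seq T) (k : 'I_(size s)) j :
  exists k' : 'I_(size s), rot j (rot k s) = rot k' s.
Proof.
have s_gt0 : (0 < size s)%N := leq_ltn_trans (leq0n k) (ltn_ord k).
have le_k : (k <= size s)%N := ltnW (ltn_ord k).
have full m : (size s <= m)%N -> rot m (rot k s) = rot k s.
  by move=> le; apply: rot_oversize; rewrite size_rot.
case: (leqP (size s) j) => [/full e|lt_j]; first by exists k.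
rewrite (rot_add_mod le_k (ltnW lt_j)); have [|lt] := ifP.
  rewrite leq_eqVlt => /predU1P[->|lt]; last by exists (Ordinal lt).
  by exists (Ordinal s_gt0); rewrite rot_size rot0.
have lt' : (j + k - size s < size s)%N.
  by rewrite ltn_subLR -?addSn ?leq_add // ltnW // ltnNge lt.
by exists (Ordinal lt').
Qed.

Lemma alternate_sym (T : eqType) (s : seq T) : symmetric (alternate s).
Proof.
suff H v w : alternate s v w -> alternate s w v.
  by move=> v w; apply/idP/idP; exact: H.
case/existsP=> k sub; set r := rot k s in sub.
suff [j sub'] : exists j, subseq [:: w; v; w; v] (rot j r).
  by have [k' ek'] := rot_rot_ord k j; apply/existsP; exists k'; rewrite -ek'.
have [a [b [-> subb]]] : exists a b, r = a ++ v :: b /\ subseq [:: w; v; w] b.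
  elim: {k}r sub => [//|x r IH] /=; case: eqP => [-> sub|_ /IH[a [b [-> sub]]]].
    by exists [::], r.
  by exists (x :: a), b.
exists (size (rcons a v)); rewrite -cat_rcons rot_size_cat.
by rewrite (@cat_subseq _ [:: w; v; w] [:: v]) // sub1seq mem_rcons mem_head.
Qed.

(* A graph is given by its half-edges: an edge is a pair {h, mate h}; an edge
   whose two half-edges sit at the same vertex is a loop. *)
Record graph4 := Graph4 {
  vert : finType;
  halfedge : finType;
  source : halfedge -> vert;
  mate : halfedge -> halfedge;
  mateK : involutive mate;
  mate_neq : forall h, mate h != h;
  deg4 : forall v, #|[set h | source h == v]| = 4%N;
  ufree_loops : nat
}.

Section Euler.
Variable U : graph4.

Definition uadj : rel (vert U) :=
  fun v w => [exists h, (source h == v) && (source (mate h) == w)].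

Definition ncomponents : nat := (n_comp uadj (vert U) + ufree_loops U)%N.

(* A closed walk is a cyclic sequence of half-edges; the entry h stands for the
   edge {h, mate h} traversed from source h to source (mate h). *)
Definition closed_walk (c : seq (halfedge U)) : bool :=
  cycle (fun h h' => source (mate h) == source h') c.

(* c is an Euler circuit of the connected component containing v. *)
Definition euler_circuit (v : vert U) (c : seq (halfedge U)) : bool :=
  [&& closed_walk c,
      all (fun h => connect uadj v (source h)) c
    & [forall h, connect uadj v (source h) ==>
                 (count (pred2 h (mate h)) c == 1%N)]].

(* Each circuit is represented with some direction and some starting point,
   and the set of circuits is listed in some order. *)
Definition euler_system (C : seq (seq (halfedge U))) : bool :=
  all (fun c => [exists v, euler_circuit v c]) C
  && [forall v, count (euler_circuit v) C == 1%N].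

Variable C : seq (seq (halfedge U)).

Definition interlaced : rel (vert U) := fun v w =>
  (v != w) && has (fun c => alternate [seq source h | h <- c] v w) C.

Lemma interlaced_irr : irreflexive interlaced.
Proof. by move=> v; rewrite /interlaced eqxx. Qed.

Lemma interlaced_sym : symmetric interlaced.
Proof.
move=> v w; rewrite /interlaced eq_sym; congr andb.
by apply: eq_has => c; rewrite alternate_sym.
Qed.

(* Transitions are partitions of the half-edges at a vertex into two pairs; the
   type also contains sets of sets that are not of this form. *)
Definition transition := {set {set halfedge U}}.

(* Some circuit of C arrives at a vertex along h and leaves it along h'; the
   entry for the edge along which it arrives is mate h. *)
Definition follows (h h' : halfedge U) : bool :=
  has (fun c => (mate h \in c) && (h' == next c (mate h))) C.

Definition follow_transition (v : vert U) : transition :=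
  [set P : {set halfedge U} | [exists h, exists h',
     [&& source h == v, follows h h' & P == [set h; h']]]].

Definition outgoing (h : halfedge U) : bool := h \in flatten C.
Definition incoming (h : halfedge U) : bool := mate h \in flatten C.

Definition consistent (tau : transition) : bool :=
  [forall P in tau,
    [exists h in P, incoming h] && [exists h in P, outgoing h]].

Inductive transition_kind := KF | KN | KI.

Definition kind (v : vert U) (tau : transition) : transition_kind :=
  if tau == follow_transition v then KF
  else if consistent tau then KN else KI.

End Euler.

Section Curves.
Variable R : realType.

Definition smooth (f : R -> R) : Prop :=
  forall k x, derivable (derive1n k f) x 1.

Definition piecewise_smooth (g : R -> R * R) : Prop :=
  exists s : seq R,
    [/\ path <%R 0 s, last 0 s = 1
      & forall j, (j < size s)%N ->
        exists f1 f2 : R -> R, [/\ smooth f1, smooth f2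
          & forall t, nth 0 (0 :: s) j <= t <= nth 0 s j -> g t = (f1 t, f2 t)]].

Definition differentiable_curve_at (g : R -> R * R) (t : R) : Prop :=
  derivable (fun s => (g s).1) t 1 /\ derivable (fun s => (g s).2) t 1.

Definition velocity (g : R -> R * R) (t : R) : R * R :=
  (derive1 (fun s => (g s).1) t, derive1 (fun s => (g s).2) t).

Definition cross (u v : R * R) : R := u.1 * v.2 - u.2 * v.1.

End Curves.

(* A closed curve is a function of period 1, oriented by its parameter, with
   parameters in [0, 1[ as representatives.  The two passages through the
   double point x are (x, true) and (x, false); at a classical crossing inl x
   the first one is the overpass.  Since passage is injective, double_points
   excludes triple points.  Corners are allowed, except at classical crossings,
   where the two tangents must exist and be independent. *)
Record diagram (R : realType) := Diagram {
  ncomp : nat;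
  nclassical : nat;
  nvirtual : nat;
  curve : 'I_ncomp -> R -> R * R;
  passage : ('I_nclassical + 'I_nvirtual) * bool -> 'I_ncomp * R;
  ncomp_gt0 : (0 < ncomp)%N;
  curve_closed : forall i t, curve i (t + 1) = curve i t;
  curve_smooth : forall i, piecewise_smooth (curve i);
  passage_range : forall p, 0 <= (passage p).2 < 1;
  passage_inj : injective passage;
  double_points : forall i j s t, 0 <= s < 1 -> 0 <= t < 1 ->
    curve i s = curve j t <->
    (i, s) = (j, t) \/
    exists x b, passage (x, b) = (i, s) /\ passage (x, ~~ b) = (j, t);
  tangent : forall x b, let p := passage (inl x, b) in
    differentiable_curve_at (curve p.1) p.2;
  transverse : forall x,
    let o := passage (inl x, true) in let u := passage (inl x, false) in
    cross (velocity (curve o.1) o.2) (velocity (curve u.1) u.2) != 0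
}.

Section Universe.
Variables (R : realType) (D : diagram R).
Local Notation n := (nclassical D).

(* Positive: the overpass direction turns counterclockwise, by an angle less
   than pi, onto the underpass direction. *)
Definition crossing_sign (x : 'I_n) : R :=
  let o := passage (inl x, true) in let u := passage (inl x, false) in
  cross (velocity (curve o.1) o.2) (velocity (curve u.1) u.2).

Definition positive (x : 'I_n) : bool := 0 < crossing_sign x.
Definition negative (x : 'I_n) : bool := crossing_sign x < 0.

Definition cpassage := ('I_n * bool)%type.

Definition comp_of (p : cpassage) : 'I_(ncomp D) := (passage (inl p.1, p.2)).1.
Definition time_of (p : cpassage) : R := (passage (inl p.1, p.2)).2.

(* Parameter length, in ]0, 1], of the stretch of link component that leads
   from p to q in the direction of the orientation. *)
Definition gap (p q : cpassage) : R :=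
  if time_of p < time_of q then time_of q - time_of p
  else time_of q - time_of p + 1.

Definition next_passage (p : cpassage) : cpassage :=
  [arg min_(q < p | comp_of q == comp_of p) gap p q]%O.
Definition prev_passage (p : cpassage) : cpassage :=
  [arg min_(q < p | comp_of q == comp_of p) gap q p]%O.

Lemma next_passageK : cancel next_passage prev_passage.
Proof.
move=> p; rewrite /prev_passage; set q := next_passage p.
have [cq minq] : comp_of q = comp_of p /\
    forall r, comp_of r = comp_of p -> gap p q <= gap p r.
  rewrite /q /next_passage; case: arg_minP => //= q' /eqP cq' minq'.
  by split=> // r cr; apply: minq'; apply/eqP.
case: arg_minP => //= p' /eqP cp' minp'; rewrite cq in cp'.
have := minp' p; rewrite cq eqxx => /(_ isT); have := minq _ cp'.
have := passage_range (inl p.1, p.2); have := passage_range (inl q.1, q.2).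
have := passage_range (inl p'.1, p'.2).
rewrite -!/(time_of _) => /andP[? ?] /andP[? ?] /andP[? ?] le1 le2.
have et : time_of p' = time_of p.
  move: le1 le2; rewrite /gap.
  by case: ltP => ?; case: ltP => ?; case: ltP => ?; lra.
have : passage (d := D) (inl p'.1, p'.2) = passage (inl p.1, p.2).
  by apply/eqP; rewrite -pair_eqE /pair_eq; apply/andP; split; apply/eqP.
case/passage_inj => e1 e2.
by rewrite [p']surjective_pairing [p in RHS]surjective_pairing e1 e2.
Qed.

Lemma prev_passageK : cancel prev_passage next_passage.
Proof. exact: canF_sym next_passageK. Qed.

(* (p, true) leaves the crossing and (p, false) arrives at it. *)
Definition dhalf := (cpassage * bool)%type.
Definition dhalf_source (h : dhalf) : 'I_n := h.1.1.
Definition dhalf_mate (h : dhalf) : dhalf :=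
  if h.2 then (next_passage h.1, false) else (prev_passage h.1, true).

Lemma dhalf_mateK : involutive dhalf_mate.
Proof. by case=> p [] /=; rewrite /dhalf_mate /= ?next_passageK ?prev_passageK. Qed.

Lemma dhalf_mate_neq h : dhalf_mate h != h.
Proof. by case: h => p []; rewrite /dhalf_mate xpair_eqE andbF. Qed.

Lemma dhalf_deg4 v : #|[set h | dhalf_source h == v]| = 4%N.
Proof.
pose f (b : bool * bool) : dhalf := ((v, b.1), b.2).
have -> : [set h | dhalf_source h == v] = f @: [set: bool * bool].
  apply/setP=> -[[x b1] b2]; rewrite inE; apply/eqP/imsetP => /=.
    by rewrite /dhalf_source /= => ->; exists (b1, b2); rewrite ?inE.
  by case=> b _ [->].
rewrite card_imset ?cardsT ?card_prod ?card_bool //.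
by move=> [? ?] [? ?] [-> ->].
Qed.

Definition crossing_free : nat :=
  #|[set i : 'I_(ncomp D) | ~~ [exists p : cpassage, comp_of p == i]]|.

Definition universe : graph4 :=
  Graph4 dhalf_mateK dhalf_mate_neq dhalf_deg4 crossing_free.

Definition over_out (x : 'I_n) : halfedge universe := ((x, true), true).
Definition over_in (x : 'I_n) : halfedge universe := ((x, true), false).
Definition under_out (x : 'I_n) : halfedge universe := ((x, false), true).
Definition under_in (x : 'I_n) : halfedge universe := ((x, false), false).

Definition oriented_smoothing (x : 'I_n) : transition universe :=
  [set [set over_in x; under_out x]; [set under_in x; over_out x]].
Definition unoriented_smoothing (x : 'I_n) : transition universe :=
  [set [set over_in x; under_in x]; [set over_out x; under_out x]].

Section Interlacement.
Variable C : seq (seq (halfedge universe)).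

(* When C is an Euler system the last case does not occur. *)
Definition crossing_mark (x : 'I_n) : mark :=
  match kind C (x : vert universe) (oriented_smoothing x),
        kind C (x : vert universe) (unoriented_smoothing x) with
  | KN, KI => Unmarked
  | KI, KN => Mr
  | KF, KI => Mc
  | KI, KF => Mcr
  | KN, KF => Mu
  | KF, KN => Mur
  | _, _ => Unmarked
  end.

Definition interlacement_graph : marked_graph :=
  @MarkedGraph n (interlaced C) (interlaced_irr C) (@interlaced_sym universe C)
    negative crossing_mark (ncomponents universe - 1).

End Interlacement.

Definition A_smoothing (x : 'I_n) : transition universe :=
  if positive x then oriented_smoothing x else unoriented_smoothing x.
Definition B_smoothing (x : 'I_n) : transition universe :=
  if positive x then unoriented_smoothing x else oriented_smoothing x.

(* A state is encoded by the set S of the crossings with an A smoothing. *)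
Definition state_smoothing (S : {set 'I_n}) (x : 'I_n) : transition universe :=
  if x \in S then A_smoothing x else B_smoothing x.

Definition state_adj (S : {set 'I_n}) : rel (halfedge universe) := fun h h' =>
  (h' == mate h) || ([set h; h'] \in state_smoothing S (source h)).

Definition state_curves (S : {set 'I_n}) : nat :=
  (n_comp (state_adj S) (halfedge universe) + crossing_free)%N.

Definition kauffman_bracket : ZABd :=
  \sum_(S : {set 'I_n})
    polyA ^+ #|S| * polyB ^+ #|~: S| * polyd ^+ (state_curves S - 1).

End Universe.

(* Main.v *)
Require Import Defs.
From mathcomp Require Import all_classical all_reals.
From mathcomp Require Import all_boot all_order all_algebra mxabelem.

(** Fix a state S and consider the functions from the edges of the universe to
    GF(2) that are constant on the closed curves of S; there are 2 ^ c(S) of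
    them, free loops aside.  At each of its two passages through a crossing v
    along the Euler circuit such a function f makes a jump, and both jumps have
    the same value x v, because the smoothing at v pairs the four half-edges.
    Conversely a vector x is integrated along the Euler circuits (every crossing
    is passed twice, so the jumps of a circuit cancel), uniquely up to a constant
    on each circuit.  Between the two passages through v the integral changes by
    the sum of x v and of the x w with w interlaced with v, so that it is
    constant on the curves of S iff x v = 0 where S follows C, and the row v of
    (A(G)_T) x = 0 holds elsewhere.  Hence
    2 ^ c(S) = 2 ^ nullity(A(G)_T) * 2 ^ c(U). *)

Set Implicit Arguments.
Unset Strict Implicit.
Unset Printing Implicit Defensive.
Import Order.TTheory GRing.Theory.
Local Open Scope ring_scope.

(** * Counting over GF(2) *)

Lemma addF2_eq0 (x y : 'F_2) : (x + y == 0) = (x == y).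
Proof. by case: x y => [[|[|?]] ?] [[|[|?]] ?]. Qed.

Lemma addF2xx (x : 'F_2) : x + x = 0.
Proof. by apply/eqP; rewrite addF2_eq0. Qed.

Lemma addF2K (x y : 'F_2) : x + (x + y) = y.
Proof. by rewrite addrA addF2xx add0r. Qed.

Lemma addF2Kr (x y : 'F_2) : x + y + y = x.
Proof. by rewrite addrC addrA addrC addF2K. Qed.

Lemma mulrnF2 (x : 'F_2) n : x *+ n = (odd n)%:R * x.
Proof.
elim: n => [|n IHn]; first by rewrite mulr0n mul0r.
rewrite mulrS IHn /=; case: (odd n); rewrite ?mul1r ?mul0r ?addr0 //=.
by apply/eqP; rewrite addF2_eq0.
Qed.

Lemma sum_count_mem (T : finType) (x : T -> 'F_2) (s : seq T) :
  \sum_(w <- s) x w = \sum_w (odd (count_mem w s))%:R * x w.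
Proof.
under [RHS]eq_bigr do rewrite -mulrnF2.
elim: s => [|v s IHs]; first by rewrite big_nil big1.
rewrite big_cons IHs [RHS](eq_bigr (fun w => (if w == v then x w else 0)
    + x w *+ count_mem w s)) => [|w _]; last first.
  by rewrite /= eq_sym mulrnDr; case: eqP.
by rewrite big_split -big_mkcond big_pred1_eq.
Qed.

(** An invariant function is determined by its values at the component roots, and these values are
    arbitrary. *)
Lemma card_invariant (T : finType) (e : rel T) : connect_sym e ->
  #|[set f : {ffun T -> 'F_2} | [forall x, forall y, e x y ==> (f x == f y)]]|
  = (2 ^ n_comp e T)%N.
Proof.
move=> sym_e; set W := [set f | _].
have <- : #|pffun_on (0 : 'F_2) [predI fingraph.roots e & T] predT|
          = (2 ^ n_comp e T)%N.
  by rewrite card_pffun_on cardT size_enum_ord.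
pose ext (f : {ffun T -> 'F_2}) := [ffun x => f (fingraph.root e x)].
rewrite -[RHS](card_in_imset (f := ext)) => [|f g Df Dg /ffunP efg].
  apply/eq_card => f; rewrite inE; apply/idP/imsetP.
    move/forallP => inv_f.
    have conn_f x y : connect e x y -> f x = f y.
      case/connectP=> p; elim: p x => [x _ ->|z p IHp x] //= /andP[exz pth] def_y.
      by rewrite (eqP (implyP (forallP (inv_f x) z) exz)) (IHp z).
    exists [ffun x => if fingraph.roots e x then f x else 0].
      apply/pffun_onP; split=> //; apply/fintype.subsetP => x; rewrite !inE ffunE.
      by case: (fingraph.roots e x) => //; rewrite eqxx.
    by apply/ffunP => x; rewrite !ffunE roots_root // (conn_f _ _ (connect_root _ _)).
  case=> g _ ->; apply/forallP=> x; apply/forallP=> y; apply/implyP => exy.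
  rewrite !ffunE.
  by rewrite (fingraph.rootP sym_e (connect1 exy)).
apply/ffunP => x; have [rx|nrx] := boolP (fingraph.roots e x).
  by have := efg x; rewrite !ffunE (eqP rx).
have out h : h \in pffun_on 0 [predI fingraph.roots e & T] predT -> h x = 0.
  case/pffun_onP=> /fintype.subsetP/(_ x) sup _; apply/eqP/idPn => hx.
  by have := sup hx; rewrite !inE (negPf nrx).
by rewrite !out.
Qed.

(** The vector stands on the left of [M], so restriction to [K] identifies the solutions with the
    left kernel of the submatrix: entries outside [K] vanish and contribute nothing. *)
Lemma card_supported_kernel (F : finFieldType) n (M : 'M[F]_n) (K : {set 'I_n}) :
  #|[set x : {ffun 'I_n -> F} | [forall v,
      if v \in K then \sum_w x w * M w v == 0 else x v == 0]]|
  = (#|F| ^ (#|K| - \rank (mxsub enum_val enum_val M : 'M_#|K|)))%N.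
Proof.
set N := mxsub _ _ _; set X := [set x | _].
rewrite -mxrank_ker -card_rowg.
pose res (x : {ffun 'I_n -> F}) : 'rV_#|K| := \row_i x (enum_val i).
have sumK (x : {ffun 'I_n -> F}) v : (forall w, w \notin K -> x w = 0) ->
    \sum_w x w * M w v = \sum_i x (enum_val (i : 'I_#|K|)) * M (enum_val i) v.
  move=> supp; rewrite (bigID (mem K)) /= [X in _ + X]big1 ?addr0 => [|w /supp->].
    by rewrite big_enum_val.
  by rewrite mul0r.
rewrite -(card_in_imset (f := res)) => [|x y].
  apply/eq_card => u; rewrite inE sub_kermx; apply/imsetP/eqP.
    case=> x; rewrite inE => /forallP Xx ->; apply/rowP => j; rewrite !mxE.
    have := Xx (enum_val j); rewrite enum_valP => /eqP XxE.
    rewrite -[RHS]XxE sumK => [|w nKw]; last first.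
      by have := Xx w; rewrite (negPf nKw) => /eqP.
    by apply: eq_bigr => i _; rewrite !mxE.
  move=> uN0.
  (* At most one index [i] enumerates [v], so this sum extends [u] by 0 outside [K]. *)
  pose x := [ffun v => \sum_(i < #|K| | enum_val i == v) u 0 i].
  have xE i : x (enum_val i) = u 0 i.
    rewrite ffunE (eq_bigl (pred1 i)) ?big_pred1_eq // => j /=.
    by rewrite (inj_eq enum_val_inj).
  have supp w : w \notin K -> x w = 0.
    by move=> nKw; rewrite ffunE big1 // => i /eqP ew; rewrite -ew enum_valP in nKw.
  exists x; last by apply/rowP=> i; rewrite mxE xE.
  rewrite inE; apply/forallP => v; case: ifPn => [Kv|/supp->] //.
  rewrite sumK //; have /rowP/(_ (enum_rank_in Kv v)) := uN0; rewrite !mxE => uN0v.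
  rewrite -[X in _ == X]uN0v.
  by apply/eqP/eq_bigr => i _; rewrite xE !mxE enum_rankK_in.
rewrite !inE => /forallP Xx /forallP Xy /rowP exy; apply/ffunP=> v.
have := Xx v; have := Xy v; have [Kv _ _|_ /eqP-> /eqP->] := ifPn; last by [].
by have := exy (enum_rank_in Kv v); rewrite !mxE enum_rankK_in.
Qed.

(** * Alternation in cyclic words *)

Lemma alternateP (T : eqType) (s : seq T) v w :
  reflect (exists k, subseq [:: v; w; v; w] (rot k s)) (alternate s v w).
Proof.
apply: (iffP existsP) => [[k sub]|[k sub]]; first by exists k.
have [lt_k|le_k] := ltnP k (size s); first by exists (Ordinal lt_k).
case: s => [|x s] in sub le_k *; first by rewrite rot_oversize in sub.
by exists ord0; rewrite rot0 -(rot_oversize le_k).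
Qed.

Lemma alternate_rot (T : eqType) (s : seq T) j v w :
  alternate (rot j s) v w = alternate s v w.
Proof.
have rotW (t : seq T) i : alternate (rot i t) v w -> alternate t v w.
  case: t => [|x t]; first by rewrite rot_oversize.
  have [k0 ->] : exists k0 : 'I_(size (x :: t)),
      rot i (x :: t) = rot k0 (x :: t).
    have [k0 e0] := rot_rot_ord (ord0 : 'I_(size (x :: t))) i.
    by exists k0; rewrite -e0 rot0.
  case/alternateP=> k; have [k' ->] := rot_rot_ord k0 k => sub.
  by apply/alternateP; exists k'.
apply/idP/idP; first exact: rotW.
by rewrite -{1}(rotK j s); apply: rotW.
Qed.

(** Stripped of all letters except [v] and [w], the word is one [v], a block of p letters [w], the
    other [v] and a block of q letters [w], with p + q equal to 0 or 2. It alternates exactly when p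
    = q = 1, that is, when p is odd. The total 0 covers a [w] off the circuit. *)
Lemma alternate_odd (T : eqType) (b d : seq T) v w :
  v != w -> v \notin b ++ d -> count_mem w (b ++ d) \in [:: 0; 2]%N ->
  alternate (v :: b ++ v :: d) v w = odd (count_mem w b).
Proof.
move=> neq_vw; have neq_wv : (w == v) = false by rewrite eq_sym (negPf neq_vw).
rewrite mem_cat negb_or => /andP[v'b v'd].
have filterE e : v \notin e -> filter (pred2 v w) e = nseq (count_mem w e) w.
  elim: e => //= x e IHe; rewrite inE negb_or eq_sym => /andP[/negPf-> /IHe->].
  by case: eqP => [->|].
rewrite count_cat => cw; apply/alternateP/idP=> [[k]|odd_b].
  set s := v :: b ++ _ => sub.
  have {sub}: subseq [:: v; w; v; w] (filter (pred2 v w) (rot k s)).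
    by rewrite subseq_filter sub /= !eqxx !orbT.
  (* A filtered rotation is a rotation of the filtered word, which leaves finitely many short words
     to inspect. *)
  rewrite {1}/rot filter_cat -(rot_size_cat (filter _ (take k s))).
  rewrite -filter_cat cat_take_drop.
  move: (size _) => m; rewrite /s /= filter_cat /= eqxx /= !filterE //.
  move: (count_mem w b) (count_mem w d) cw => p q; rewrite !inE.
  case: p q => [|[|[|p]]] [|[|[|q]]] // _ /=; case: m => [|[|[|[|m]]]];
    by rewrite /rot /=; do 4?rewrite ?eqxx ?(negPf neq_vw) ?neq_wv //=.
have has_w e : odd (count_mem w e) -> w \in e.
  by rewrite -has_pred1 has_count; case: count.
have odd_d : odd (count_mem w d).
  by move: cw; rewrite !inE => /orP[]/eqP/(congr1 odd); rewrite oddD odd_b; case: odd.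
exists 0; rewrite rot0 /= eqxx (@cat_subseq _ [:: w] [:: v; w]) ?sub1seq ?has_w //=.
by rewrite eqxx sub1seq has_w.
Qed.

(** * Euler systems *)

Section EulerSystem.
Variables (U : graph4) (C : seq (seq (halfedge U))).
Hypothesis eulC : euler_system C.
Implicit Types (v w : vert U) (c : seq (halfedge U)) (h : halfedge U).

Lemma uadj_connect_sym : connect_sym (@uadj U).
Proof.
apply: sym_connect_sym => v w; rewrite /uadj.
by apply/existsP/existsP=> -[h /andP[/eqP<- /eqP<-]]; exists (mate h);
  rewrite mateK !eqxx.
Qed.

Lemma connect_mate h : connect (@uadj U) (source h) (source (mate h)).
Proof. by apply/connect1/existsP; exists h; rewrite !eqxx. Qed.

Lemma euler_circuit_connect v w c :
  connect (@uadj U) v w -> euler_circuit v c = euler_circuit w c.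
Proof.
move=> con_vw; rewrite /euler_circuit; do ![congr andb].
  by apply: eq_all => h; rewrite (same_connect uadj_connect_sym con_vw).
by apply: eq_forallb => h; rewrite (same_connect uadj_connect_sym con_vw).
Qed.

Lemma euler_circuit_of c h :
  c \in C -> (h \in c) || (mate h \in c) -> euler_circuit (source h) c.
Proof.
case/andP: eulC => /allP exC _ /exC/existsP[v eul_c] hc.
rewrite -(@euler_circuit_connect v) //; case/and3P: eul_c => _ /allP con_c _.
have [/con_c //|/= mhc] := orP hc.
by rewrite (connect_trans (con_c _ mhc)) // -{2}(mateK h) connect_mate.
Qed.

(** The boolean is read as a number: an occurrence of either half of the edge would make [c] the
    Euler circuit of the component of [source h]. *)
Lemma count_edge c h :
  c \in C -> count (pred2 h (mate h)) c = euler_circuit (source h) c.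
Proof.
move=> Cc; have [eul_c|not_eul] := boolP (euler_circuit _ _).
  by case/and3P: eul_c => _ _ /forallP/(_ h); rewrite connect0 => /eqP.
apply/eqP; rewrite -leqn0 leqNgt -has_count; apply/hasPn=> g gc /=.
by apply: contra not_eul => /pred2P e_g; apply: euler_circuit_of => //;
  case: e_g => <-; rewrite gc ?orbT.
Qed.

Lemma count_edge_flatten h : count (pred2 h (mate h)) (flatten C) = 1%N.
Proof.
case/andP: eulC => _ /forallP/(_ (source h))/eqP <-.
rewrite count_flatten -sum1_count big_mkcond /= sumnE big_map.
by apply: eq_big_seq => c /count_edge->; case: euler_circuit.
Qed.

Lemma count_pred2 (s : seq (halfedge U)) h :
  count (pred2 h (mate h)) s = (count_mem h s + count_mem (mate h) s)%N.
Proof.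
rewrite -[LHS]addn0 -(count_pred0 s) -[RHS]count_predUI.
congr (_ + _)%N; apply: eq_count => g //=; apply/esym/andP.
by case=> /eqP-> /eqP e_h; have := mate_neq h; rewrite -e_h eqxx.
Qed.

Lemma uniq_flatten_euler : uniq (flatten C).
Proof.
apply: count_mem_uniq => h; have := count_edge_flatten h; rewrite count_pred2.
by rewrite -has_pred1 has_count; case: (count_mem h _) => [|[]].
Qed.

(** Every edge is traversed once in all, in one direction. Hence [flatten C] selects one half of
    each edge, the one at which the traversal departs. *)
Lemma mem_mate_euler h : (mate h \in flatten C) = (h \notin flatten C).
Proof.
have := count_edge_flatten h; rewrite count_pred2.
rewrite !count_uniq_mem ?uniq_flatten_euler //.
by do 2!case: (_ \in _).
Qed.

Lemma uniq_circuit c : c \in C -> uniq c.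
Proof.
have := uniq_flatten_euler; elim: C => //= c' C' IHC.
by rewrite cat_uniq inE => /and3P[uc' _ /IHC uC'] /predU1P[->|/uC'].
Qed.

Lemma circuit_unique c c' v :
  c \in C -> c' \in C -> euler_circuit v c -> euler_circuit v c' -> c = c'.
Proof.
case/andP: eulC => _ /forallP/(_ v); rewrite -size_filter => sz Cc Cc' ec ec'.
have := mem_filter (euler_circuit v) c C; rewrite ec Cc.
have := mem_filter (euler_circuit v) c' C; rewrite ec' Cc'.
case: filter sz => [|x [|]] //= _; rewrite !inE => /eqP-> /eqP->.
by [].
Qed.

Lemma circuit_at v : exists2 c, c \in C & euler_circuit v c.
Proof.
case/andP: eulC => _ /forallP/(_ v) cv.
by apply/hasP; rewrite has_count (eqP cv).
Qed.

Lemma circuit_walk c : c \in C -> closed_walk c.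
Proof. by case/andP: eulC => /allP exC _ /exC/existsP[v /and3P[]]. Qed.

(** Of the four half-edges at [v], the departures lie in [c] and the arrivals have their mates
    there; both are equally many, so there are two departures. *)
Lemma count_source c v : c \in C -> euler_circuit v c ->
  count_mem v (map (@source U) c) = 2%N.
Proof.
move=> Cc eul_c.
have mate_c h : source h = v -> (mate h \in c) = (h \notin c).
  move=> def_v; have := count_edge h Cc; rewrite def_v eul_c count_pred2.
  by rewrite !count_uniq_mem ?uniq_circuit //; do 2!case: (_ \in _).
(* A closed walk arrives at v as often as it leaves v. *)
have in_out : count_mem v (map (@source U \o @mate U) c)
            = count_mem v (map (@source U) c).
  have -> : map (@source U \o @mate U) c = map (@source U) (rot 1 c).
    move: (circuit_walk Cc); case: c {Cc eul_c mate_c} => [//|h0 c].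
    rewrite /closed_walk rot1_cons -{2}(belast_rcons h0 c h0) /=.
    by move: (rcons c h0) => p; elim: p h0 => //= h p IHp g /andP[/eqP-> /IHp->].
  by rewrite map_rot; apply/permP; rewrite perm_rot.
have countE t : uniq t ->
    count_mem v (map (@source U) t) = #|[predI [set h | source h == v] & mem t]|.
  move=> ut; rewrite count_map -size_filter.
  rewrite -(card_uniqP (filter_uniq _ ut)); apply: eq_card => h.
  by rewrite mem_filter !inE.
have uc := uniq_circuit Cc.
have := deg4 v; rewrite -(cardID (mem c)) => card4.
move: in_out; rewrite map_comp (countE _ uc) countE => [in_out|]; last first.
  by rewrite (map_inj_uniq (can_inj (@mateK U))).
have in_outC : #|[predI [set h | source h == v] & mem (map (@mate U) c)]|
    = #|[predD [set h | source h == v] & c]|.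
  apply: eq_card => h; rewrite !inE andbC; case: eqP => [def_v|]; rewrite ?andbF //.
  by rewrite !andbT -{1}(mateK h) (mem_map (can_inj (@mateK U))) mate_c.
move: card4; rewrite -in_outC in_out addnn => /(congr1 half).
by rewrite doubleK.
Qed.

(** Normal form at [v]: the circuit is rotated to start at one passage, and [b] and [d] are the
    stretches between the two passages. *)
Lemma passages v : exists c k b d h1 h2,
  [/\ c \in C, rot k c = h1 :: b ++ h2 :: d, source h1 = v, source h2 = v
    & v \notin map (@source U) (b ++ d)].
Proof.
have [c Cc eul_c] := circuit_at v; have := count_source Cc eul_c => count_v.
have /mapP[h1 c_h1 def_h1] : v \in map (@source U) c.
  by rewrite -has_pred1 has_count count_v.
have [k c' def_c'] := rot_to c_h1.
have count1 : count_mem v (map (@source U) c') = 1%N.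
  apply: succn_inj; rewrite -count_v.
  have /permP <- : perm_eq (map (@source U) (rot k c)) (map (@source U) c).
    by rewrite map_rot perm_rot.
  by rewrite def_c' /= -def_h1 eqxx.
have /mapP[h2 c_h2 def_h2] : v \in map (@source U) c'.
  by rewrite -has_pred1 has_count count1.
case/splitPr: c_h2 => b d in def_c' count1.
exists c, k, b, d, h1, h2; split=> //; rewrite -has_pred1 has_count.
move: count1; rewrite !map_cat !count_cat /= -def_h2 eqxx.
by rewrite addnCA add1n => -[->].
Qed.

Lemma circuit_source c v : c \in C -> v \in map (@source U) c -> euler_circuit v c.
Proof. by move=> Cc /mapP[h hc ->]; apply: euler_circuit_of => //; rewrite hc. Qed.

(** A vertex [w] other than [v] occurs twice on the circuit or not at all, so [alternate_odd]
    applies. A parity is what a sum over GF(2) along [b] can detect. *)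
Lemma interlaced_odd c k b d h1 h2 v w : c \in C ->
  rot k c = h1 :: b ++ h2 :: d -> source h1 = v -> source h2 = v ->
  v \notin map (@source U) (b ++ d) ->
  interlaced C v w = odd (count_mem w (map (@source U) b)).
Proof.
move=> Cc def_c src1 src2 v'bd; rewrite /interlaced.
have [<-|neq_vw] := eqVneq.
  by move: v'bd; rewrite map_cat mem_cat negb_or => /andP[/count_memPn-> _].
have sub_c : map (@source U) (rot k c)
    = v :: map (@source U) b ++ v :: map (@source U) d.
  by rewrite def_c /= map_cat /= src1 src2.
have c_v : v \in map (@source U) c by rewrite -(mem_rot k) -map_rot sub_c mem_head.
have count_w : count_mem w (map (@source U) (b ++ d))
             = count_mem w (map (@source U) c).
  have /permP <- : perm_eq (map (@source U) (rot k c)) (map (@source U) c).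
    by rewrite map_rot perm_rot.
  by rewrite sub_c map_cat /= !count_cat /= (negPf neq_vw).
rewrite -(@alternate_odd _ _ (map (@source U) d) v) // -?map_cat //; last first.
  rewrite count_w; have [c_w|/count_memPn->//] := boolP (w \in map (@source U) c).
  by rewrite count_source // circuit_source.
rewrite -sub_c map_rot alternate_rot.
(* Any circuit that witnesses the interlacement passes through [v] and is therefore [c]. *)
apply/hasP/idP=> [[c' Cc' alt']|]; last by exists c.
have c'_v : v \in map (@source U) c'.
  by case/alternateP: alt' => j /mem_subseq/(_ v (mem_head _ _)); rewrite mem_rot.
by rewrite (circuit_unique Cc Cc' (circuit_source Cc c_v)) // circuit_source.
Qed.

(** * Jumps at the passages of the Euler circuits *)

Definition jumps (f : halfedge U -> 'F_2) (x : vert U -> 'F_2) :=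
  forall p h, follows C p h -> f p + f h = x (source p).

Lemma source_next c h : c \in C -> h \in c -> source (next c h) = source (mate h).
Proof. by move=> /circuit_walk/next_cycle/[apply]/eqP. Qed.

(* The circuit through v arrives along p1 and leaves along h1, and later arrives
   along p2 and leaves along h2. *)
Record vertex_frame v (h1 h2 p1 p2 : halfedge U) : Prop := VertexFrame {
  frame_uniq : uniq [:: h1; h2; p1; p2];
  frame_source : forall h, (source h == v) = (h \in [:: h1; h2; p1; p2]);
  frame_out : [/\ h1 \in flatten C, h2 \in flatten C,
                 p1 \notin flatten C & p2 \notin flatten C];
  frame_follows : forall p h, source p = v ->
    follows C p h = ((p, h) \in [:: (p1, h1); (p2, h2)]);
  frame_jumps : forall f x, (forall h, f (mate h) = f h) -> jumps f x ->
    f p2 = f h1 + \sum_w (interlaced C v w)%:R * x w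
}.

(** The jumps met after leaving along [h1] and before arriving along [p2] are those of the stretch
    [b]; each [w] counts with the parity of its occurrences there, which is interlacement with
    [v]. *)
Lemma vertex_frame_exists v : exists h1 h2 p1 p2, vertex_frame v h1 h2 p1 p2.
Proof.
have [c [k [b [d [h1 [h2 [Cc def_c src1 src2 v'bd]]]]]]] := passages v.
pose r := rot k c; have uc := uniq_circuit Cc.
have ur : uniq r by rewrite rot_uniq.
have next_inj : injective (next r) := can_inj (prev_next ur).
have nextE h : next c h = next r h by rewrite next_rot.
have rC h : h \in r -> h \in flatten C.
  by rewrite mem_rot => hc; apply/flattenP; exists c.
have unroll (e : rel (halfedge U)) : cycle e r ->
    [/\ path e h1 b, e (last h1 b) h2 & e (last h2 d) h1].
  by rewrite /r def_c /= rcons_cat cat_path /= rcons_path => /and4P[].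
have [_ /eqP next2 /eqP next1] : [/\ path (fun g h => h == next r g) h1 b,
    h2 == next r (last h1 b) & h1 == next r (last h2 d)].
  by apply: (unroll (fun g h => h == next r g)); apply: cycle_from_next.
(* The arrivals are the mates of the entries preceding [h1] and [h2]. If [d] or [b] is empty, [last]
   returns [h2] or [h1] itself, whose edge is then a loop at [v]. *)
pose p1 := mate (last h2 d); pose p2 := mate (last h1 b).
have r_l1 : last h2 d \in r by rewrite /r def_c inE mem_cat mem_last !orbT.
have r_l2 : last h1 b \in r by rewrite /r def_c -cat_cons mem_cat mem_last.
have r_h1 : h1 \in r by rewrite /r def_c mem_head.
have r_h2 : h2 \in r by rewrite /r def_c inE mem_cat mem_head !orbT.
have C'p1 : p1 \notin flatten C by rewrite -mem_mate_euler mateK rC.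
have C'p2 : p2 \notin flatten C by rewrite -mem_mate_euler mateK rC.
have neq_h : h1 != h2.
  by move: ur; rewrite /r def_c /= mem_cat inE !negb_or -!andbA => /and3P[].
have neq_p : p1 != p2.
  apply: contraNneq neq_h => /(can_inj (@mateK U)) e_l.
  by rewrite next1 e_l -next2.
have neq_hp h p : h \in r -> p \notin flatten C -> h != p.
  by move=> /rC Ch; apply: contraNneq => <-.
have srcp1 : source p1 = v by rewrite -(source_next Cc) ?nextE -?next1 // -(mem_rot k).
have srcp2 : source p2 = v by rewrite -(source_next Cc) ?nextE -?next2 // -(mem_rot k).
exists h1, h2, p1, p2; have uniq4 : uniq [:: h1; h2; p1; p2].
  by rewrite /= !inE !negb_or neq_h neq_p; do ![apply/andP; split]; rewrite ?neq_hp.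
split; [by [] | move=> h | by split=> //; apply: rC | move=> p h srcp
  | move=> f x f_mate jmp].
- have /eqP eq4 : [set h in [:: h1; h2; p1; p2]] == [set h | source h == v].
    rewrite eqEcard deg4; apply/andP; split.
      by apply/fintype.subsetP=> g; rewrite !inE => /or4P[]/eqP->; apply/eqP.
    by rewrite cardsE (card_uniqP uniq4).
  by have /setP/(_ h) := eq4; rewrite !inE.
- apply/hasP/idP => [[c' Cc' /andP[c'p /eqP->]]|].
    have ec' : euler_circuit v c' by rewrite -srcp euler_circuit_of // c'p orbT.
    have ec : euler_circuit v c.
      by rewrite -src1 euler_circuit_of // -(mem_rot k) -/r r_h1.
    rewrite -(circuit_unique Cc Cc' ec ec') in c'p *.
    have: next r (mate p) \in r by rewrite mem_next mem_rot.
    have srcn : source (next r (mate p)) = v by rewrite -nextE source_next ?mateK.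
    rewrite nextE.
    (* As [v] is absent from [b] and [d], the successor of [mate p] must be [h1] or [h2], and
       injectivity of [next r] then recovers [p]. *)
    have nbd g : g \in b ++ d -> next r (mate p) != g.
      by move=> bdg; apply: contraNneq v'bd => e; rewrite -srcn e map_f.
    rewrite {2}/r def_c inE mem_cat inE => /or4P[/eqP|||].
    - move=> e_n; have e_p := next_inj _ _ (etrans e_n next1).
      by rewrite e_n -(mateK p) e_p mem_head.
    - move=> bn; have := nbd (next r (mate p)).
      by rewrite mem_cat bn eqxx => /(_ isT).
    - move=> /eqP e_n; have e_p := next_inj _ _ (etrans e_n next2).
      by rewrite e_n -(mateK p) e_p !inE eqxx orbT.
    - move=> dn; have := nbd (next r (mate p)).
      by rewrite mem_cat dn orbT eqxx => /(_ isT).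
  rewrite !inE => /orP[]/eqP[-> ->]; exists c => //.
    by rewrite mateK nextE -next1 eqxx -(mem_rot k) r_l1.
  by rewrite mateK nextE -next2 eqxx -(mem_rot k) r_l2.
have /unroll[path_b _ _] : cycle (fun g h => f g + f h == x (source h)) r.
  apply: cycle_from_next => // g rg; apply/eqP.
  have cg : g \in c by rewrite -(mem_rot k).
  rewrite -nextE source_next // -(jmp (mate g) (next c g)) ?f_mate //.
  by apply/hasP; exists c; rewrite // mateK cg eqxx.
rewrite /p2 f_mate.
under eq_bigr do rewrite (interlaced_odd _ Cc def_c src1 src2 v'bd).
rewrite -sum_count_mem big_map.
suff sum_path g : path (fun g h => f g + f h == x (source h)) g b ->
    f (last g b) = f g + \sum_(h <- b) x (source h) by exact: sum_path.
elim: (b) g => [|g b' IHb] g0 /=.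
  by rewrite big_nil addr0.
case/andP=> /eqP jump_g /IHb->; rewrite big_cons addrA; congr (_ + _).
by rewrite -jump_g addF2K.
Qed.

(** * Transitions as fixed-point-free involutions *)

(* A transition at every vertex, encoded by the involution that sends each
   half-edge to its partner. *)
Record pairing (theta : halfedge U -> halfedge U) : Prop := Pairing {
  pairingK : involutive theta;
  pairing_neq : forall h, theta h != h;
  pairing_source : forall h, source (theta h) = source h
}.

Definition transition_of (theta : halfedge U -> halfedge U) v : transition U :=
  [set [set h; theta h] | h in [pred h | source h == v]].

(** The partner of [p1] is one of the other three half-edges, and the remaining two are then left to
    each other. *)
Lemma pairing_cases theta v h1 h2 p1 p2 :
  pairing theta -> vertex_frame v h1 h2 p1 p2 ->
  [\/ theta p1 = h1 /\ theta p2 = h2, theta p1 = h2 /\ theta p2 = h1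
    | theta p1 = p2 /\ theta h1 = h2].
Proof.
move=> [thetaK theta_neq theta_src] [uniq4 src4 _ _ _].
have theta_mem h : h \in [:: h1; h2; p1; p2] -> theta h \in [:: h1; h2; p1; p2].
  by rewrite -!src4 theta_src.
have theta_inj := can_inj thetaK.
move: uniq4; rewrite /= !inE !negb_or.
case/and4P=> /and3P[n12 n1p1 n1p2] /andP[n2p1 n2p2] np _.
have := theta_mem p1; have := theta_mem p2; have := theta_mem h1.
rewrite !inE !eqxx !orbT /= => /(_ isT) mh1 /(_ isT) mp2 /(_ isT).
rewrite (negPf (theta_neq _)) /= => /or3P[]/eqP e1.
- constructor 1; split=> //; move: mp2.
  rewrite -{1}e1 (inj_eq theta_inj) eq_sym (negPf np).
  rewrite -[_ == p1](inj_eq theta_inj) thetaK e1 [p2 == _]eq_sym (negPf n1p2).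
  by rewrite (negPf (theta_neq _)) !orbF => /eqP.
- constructor 2; split=> //; move: mp2.
  rewrite -{1}e1 (inj_eq theta_inj) [p2 == p1]eq_sym (negPf np).
  rewrite -[_ == p1](inj_eq theta_inj) thetaK e1 [p2 == _]eq_sym (negPf n2p2).
  by rewrite (negPf (theta_neq _)) !orbF => /eqP.
- constructor 3; split=> //; move: mh1.
  rewrite (negPf (theta_neq _)) -{1}e1 (inj_eq theta_inj).
  rewrite (negPf n1p1) -[_ == p1](inj_eq theta_inj) thetaK e1 (negPf n1p2) !orbF /=.
  by move/eqP.
Qed.

Lemma transition_ofE theta v p q : pairing theta ->
  (forall h, (source h == v) = (h \in [:: p; theta p; q; theta q])) ->
  transition_of theta v = [set [set p; theta p]; [set q; theta q]].
Proof.
case=> thetaK _ _ src4; apply/setP=> P; rewrite !inE; apply/imsetP/orP.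
  case=> h; rewrite inE src4 !inE => /or4P[]/eqP-> ->; rewrite ?thetaK ?eqxx; auto.
  - by left; rewrite setUC.
  - by right; rewrite setUC.
case=> /eqP->; [exists p | exists q] => //; rewrite inE src4 !inE eqxx ?orbT //.
Qed.

Lemma follow_transitionE v h1 h2 p1 p2 : vertex_frame v h1 h2 p1 p2 ->
  follow_transition C v = [set [set p1; h1]; [set p2; h2]].
Proof.
case=> _ src4 _ fol _; apply/setP=> P; rewrite !inE; apply/existsP/orP.
  case=> p /existsP[h /and3P[/eqP srcp]]; rewrite fol // !inE.
  by case/orP=> /eqP[-> ->] ->; auto.
have srcp1 : source p1 = v by apply/eqP; rewrite src4 !inE eqxx !orbT.
have srcp2 : source p2 = v by apply/eqP; rewrite src4 !inE eqxx !orbT.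
case=> Pe; [exists p1; apply/existsP; exists h1 | exists p2; apply/existsP; exists h2].
  by rewrite srcp1 eqxx Pe fol // mem_head.
by rewrite srcp2 eqxx Pe fol // !inE eqxx orbT.
Qed.

(** Since [theta] has no fixed points, either element of a block determines the other, so the
    involution can be read off from the set of blocks. *)
Lemma mem_transition_of theta v h h' : pairing theta ->
  ([set h; h'] \in transition_of theta v) = (source h == v) && (h' == theta h).
Proof.
case=> thetaK theta_neq theta_src.
apply/imsetP/andP => [[g]|[src /eqP->]]; last by exists h.
rewrite inE => /eqP srcg /setP eq_hg; have := eq_hg h; have := eq_hg h'.
have := eq_hg g; have := eq_hg (theta g); rewrite !inE !eqxx !orbT /=.
move=> /orP m1 /orP m2 /esym/orP m3 /esym/orP[]/eqP e_h.
  rewrite e_h srcg eqxx; split=> //; case: m1 => /eqP e; last by rewrite e.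
  by have := theta_neq g; rewrite e e_h eqxx.
rewrite e_h theta_src srcg eqxx thetaK; split=> //.
case: m2 => /eqP e; last by rewrite e.
by have := theta_neq g; rewrite -e_h -e eqxx.
Qed.

(** N exchanges the departures of the two passages, so each block keeps an arrival and a departure;
    I joins the two arrivals and the two departures. *)
Lemma kind_cases theta v h1 h2 p1 p2 :
  pairing theta -> vertex_frame v h1 h2 p1 p2 ->
  match kind C v (transition_of theta v) with
  | KF => theta p1 = h1 /\ theta p2 = h2
  | KN => theta p1 = h2 /\ theta p2 = h1
  | KI => theta p1 = p2 /\ theta h1 = h2
  end.
Proof.
move=> th fr; have [uniq4 src4 [Ch1 Ch2 Cp1 Cp2] _ _] := fr.
have fE := follow_transitionE fr.
have srcp1 : source p1 == v by rewrite src4 !inE eqxx !orbT.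
have follow_p1 : transition_of theta v = follow_transition C v -> h1 = theta p1.
  move=> tE; apply/eqP; have := mem_transition_of v p1 h1 th.
  by rewrite srcp1 tE fE set21 => /esym.
move: uniq4; rewrite /= !inE !negb_or.
case/and4P=> /and3P[n12 _ n1p2] _ _ _.
have [] := pairing_cases th fr => -[e1 e2]; rewrite /kind.
- rewrite fE (@transition_ofE _ _ p1 p2) // ?e1 ?e2 ?eqxx //.
  by move=> h; rewrite src4 !inE; do 4!case: (_ == _).
- rewrite (negPf (_ : transition_of theta v != _)); last first.
    by apply: contraNneq n12 => /follow_p1->; rewrite e1.
  suff -> : consistent C (transition_of theta v) by [].
  rewrite (@transition_ofE _ _ p1 p2) // ?e1 ?e2; last first.
    by move=> h; rewrite src4 !inE; do 4!case: (_ == _).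
  apply/forall_inP=> P; rewrite !inE.
  case/orP=> /eqP->; apply/andP; split; apply/exists_inP.
  + by exists p1; rewrite ?set21 // /incoming mem_mate_euler.
  + by exists h2; rewrite ?set22.
  + by exists p2; rewrite ?set21 // /incoming mem_mate_euler.
  + by exists h1; rewrite ?set22.
rewrite (negPf (_ : transition_of theta v != _)); last first.
  by apply: contraNneq n1p2 => /follow_p1->; rewrite e1.
suff /negPf -> : ~~ consistent C (transition_of theta v) by [].
(* The block of the two arrivals contains no outgoing half-edge. *)
apply/negP=> /forall_inP/(_ [set p1; p2]).
rewrite mem_transition_of // srcp1 e1 eqxx.
case/(_ isT)/andP=> _ /exists_inP[h]; rewrite !inE /outgoing.
by case/orP=> /eqP->; [rewrite (negPf Cp1) | rewrite (negPf Cp2)].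
Qed.

(** Equal kinds give [p1] the same partner. Agreement at a single half-edge is enough to separate
    the two smoothings, which pair no half-edge alike. *)
Lemma kind_inj theta theta' v : pairing theta -> pairing theta' ->
  kind C v (transition_of theta v) = kind C v (transition_of theta' v) ->
  exists2 h, source h = v & theta h = theta' h.
Proof.
move=> th th'; have [h1 [h2 [p1 [p2 fr]]]] := vertex_frame_exists v.
have srcp1 : source p1 = v by apply/eqP; rewrite (frame_source fr) !inE eqxx !orbT.
have := kind_cases th fr; have := kind_cases th' fr => + + e_k; rewrite e_k.
by case: kind => -[e1 _] [e1' _]; exists p1; rewrite // e1 e1'.
Qed.

(* The condition that smoothing v in the way k puts on the jumps x of a function
   that is constant on the resulting curves. *)
Definition jump_equation v (k : transition_kind) (x : vert U -> 'F_2) :=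
  match k with
  | KF => x v
  | KN => \sum_w (interlaced C v w)%:R * x w
  | KI => \sum_w (interlaced C v w)%:R * x w + x v
  end == 0.

Lemma jumps_frame f x v h1 h2 p1 p2 : vertex_frame v h1 h2 p1 p2 -> jumps f x ->
  f h1 = f p1 + x v /\ f h2 = f p2 + x v.
Proof.
move=> [_ src4 _ fol _] jmp.
have srcp1 : source p1 = v by apply/eqP; rewrite src4 !inE eqxx !orbT.
have srcp2 : source p2 = v by apply/eqP; rewrite src4 !inE eqxx !orbT.
split; [rewrite -srcp1 -(jmp p1 h1) | rewrite -srcp2 -(jmp p2 h2)]; rewrite ?addF2K //.
- by rewrite fol // mem_head.
- by rewrite fol // !inE eqxx orbT.
Qed.

(** With s the interlacement sum, [f] takes the values [f p1 + x v] at [h1], [f p1 + x v + s] at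
    [p2] and [f p1 + s] at [h2]. Equality on both blocks thus means [x v = 0] for F, [s = 0] for N
    and [s + x v = 0] for I. *)
Lemma pairing_invariantP theta f x v : pairing theta ->
  (forall h, f (mate h) = f h) -> jumps f x ->
  jump_equation v (kind C v (transition_of theta v)) x <->
  forall h, source h = v -> f (theta h) = f h.
Proof.
move=> th f_mate jmp; have [h1 [h2 [p1 [p2 fr]]]] := vertex_frame_exists v.
have srcp1 : source p1 = v by apply/eqP; rewrite (frame_source fr) !inE eqxx !orbT.
have [fh1 fh2] := jumps_frame fr jmp.
have fp2 := frame_jumps fr f_mate jmp; rewrite fh1 in fp2.
have thK := pairingK th.
have all4 : (forall h, source h = v -> f (theta h) = f h) <->
    [/\ f (theta h1) = f h1, f (theta h2) = f h2, f (theta p1) = f p1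
      & f (theta p2) = f p2].
  split=> [inv|[i1 i2 i3 i4] h /eqP].
    by split; apply: inv; apply/eqP; rewrite (frame_source fr) !inE eqxx ?orbT.
  by rewrite (frame_source fr) !inE => /or4P[]/eqP->.
rewrite all4 /jump_equation -(rwP eqP) => {all4}.
have := kind_cases th fr; case: kind => -[e1 e2].
- have [-> ->] : theta h1 = p1 /\ theta h2 = p2 by rewrite -e1 -e2 !thK.
  rewrite e1 e2 fh1 fh2; split=> [->|[_ _ + _]]; rewrite ?addr0 //.
  by rewrite -[RHS]addr0 => /addrI.
- have [-> ->] : theta h1 = p2 /\ theta h2 = p1 by rewrite -e1 -e2 !thK.
  rewrite e1 e2 fh2 fp2 fh1; split=> [->|[+ _ _ _]]; last first.
    by rewrite -[RHS]addr0 => /addrI.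
  by rewrite addr0 addF2Kr.
have [-> ->] : theta h2 = h1 /\ theta p2 = p1 by rewrite -e1 -e2 !thK.
rewrite e1 e2 fh2 fp2 fh1; split=> [/eqP|[_ _ + _]].
  by rewrite addF2_eq0 => /eqP->; rewrite !addF2Kr.
by rewrite -[RHS]addr0 -addrA => /addrI; rewrite addrC.
Qed.

(** Invariance makes the two jumps at a vertex equal: under F both vanish, under N and I they are
    sums of the same two values. *)
Lemma invariant_jumps theta (f : halfedge U -> 'F_2) : pairing theta ->
  (forall h, f (theta h) = f h) -> exists x, jumps f x.
Proof.
move=> th f_theta.
pose P v y := forall p h, source p = v -> follows C p h -> f p + f h = y.
suff /fin_all_exists[x xP] : forall v, exists y, P v y.
  by exists x => p h ph; apply: xP.
move=> v; have [h1 [h2 [p1 [p2 fr]]]] := vertex_frame_exists v.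
exists (f p1 + f h1) => p h srcp; rewrite (frame_follows fr) // !inE.
case/orP=> /eqP[-> ->] //.
have := f_theta p1; have := f_theta p2; have := f_theta h1.
have [] := pairing_cases th fr => -[-> ->] // e1 e2 e3.
- by rewrite e2 e3 !addF2xx.
- by rewrite e2 e3 addrC.
by rewrite e1 e3.
Qed.

(** * Integration along the Euler circuits *)

Lemma follows_source p h : follows C p h -> source h = source p.
Proof. by case/hasP=> c Cc /andP[cp /eqP->]; rewrite source_next ?mateK. Qed.

Lemma source_sum_circuit (x : vert U -> 'F_2) c :
  c \in C -> \sum_(h <- c) x (source h) = 0.
Proof.
move=> Cc; rewrite -(big_map (@source U) xpredT x) sum_count_mem big1 // => w _.
have [c_w|/count_memPn->] := boolP (w \in map (@source U) c); last by rewrite mul0r.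
by rewrite count_source ?mul0r // circuit_source.
Qed.

(** The head of [c] is the base point, with integral 0: the sum runs over the entries after the head
    up to [h] itself, so the jump at the head enters only when the circuit closes. *)
Definition circuit_integral (x : vert U -> 'F_2) c h :=
  \sum_(g <- take (index h c) (behead c)) x (source g).

Lemma circuit_integral_cycle (x : vert U -> 'F_2) c : c \in C ->
  cycle (fun g h =>
    circuit_integral x c g + circuit_integral x c h == x (source h)) c.
Proof.
move=> Cc; have := uniq_circuit Cc; have := source_sum_circuit x Cc.
case: c {Cc} => [|h0 c] //= sum0 uc.
pose f := circuit_integral x (h0 :: c); rewrite -/f.
have fE i : (i <= size c)%N ->
    f (nth h0 (h0 :: c) i) = \sum_(g <- take i c) x (source g).
  by move=> le_i; rewrite /f /circuit_integral index_uniq.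
apply/(pathP h0) => i; rewrite size_rcons ltnS => le_i.
rewrite -rcons_cons nth_rcons /= ltnS le_i fE // nth_rcons.
move: le_i; rewrite leq_eqVlt; case: ltngtP => // [lt_i|->] _.
  rewrite -[nth h0 c i]/(nth h0 (h0 :: c) i.+1) fE // (take_nth h0) // -cats1.
  by rewrite big_cat big_seq1 addF2K.
(* Closing step: at the last entry the integral sums over all entries but the head, which equals the
   jump at the head because the full sum vanishes. *)
rewrite take_size /f /circuit_integral /= eqxx take0 big_nil addr0.
rewrite eq_sym -addF2_eq0.
by rewrite big_cons in sum0; rewrite sum0.
Qed.

Lemma jumps_integral (x : vert U -> 'F_2) :
  exists f : {ffun halfedge U -> 'F_2},
  (forall h, f (mate h) = f h) /\ jumps f x.
Proof.
(* The default [[::]] is harmless: below, [F] is only evaluated at half-edges lying on some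
   circuit. *)
pose circ h := nth [::] C (find (fun c => h \in c) C).
have circE c h : c \in C -> h \in c -> circ h = c.
  move=> Cc ch; have has_h : has (fun c => h \in c) C by apply/hasP; exists c.
  have circ_h : h \in circ h by rewrite /circ (nth_find _ has_h).
  have C_circ : circ h \in C by rewrite mem_nth // -has_find.
  apply: (@circuit_unique _ _ (source h));
    by rewrite // euler_circuit_of // ?ch ?circ_h.
pose F h := circuit_integral x (circ h) h.
exists [ffun h => if h \in flatten C then F h else F (mate h)].
split=> [h | p h]; first by rewrite !ffunE mateK mem_mate_euler; case: (h \in _).
case/hasP=> c Cc /andP[cp /eqP->].
have inC g : g \in c -> g \in flatten C by move=> cg; apply/flattenP; exists c.
rewrite !ffunE -[p \in _]negbK -mem_mate_euler inC //= inC ?mem_next //.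
rewrite /F !(circE c) ?mem_next //.
by rewrite (eqP (next_cycle (circuit_integral_cycle x Cc) cp)) source_next ?mateK.
Qed.

(** Without jumps [f] is constant along the Euler circuit, which traverses every edge of the
    component in one direction or the other. *)
Lemma no_jump_connected (f : halfedge U -> 'F_2) h h' :
  (forall h, f (mate h) = f h) -> jumps f (fun=> 0) ->
  connect (@uadj U) (source h) (source h') -> f h = f h'.
Proof.
move=> f_mate jmp con; have [c Cc eul_c] := circuit_at (source h).
have f_c g g' : g \in c -> g' \in c -> f g = f g'.
  have : cycle (fun g g' => f g == f g') c.
    apply: cycle_from_next (uniq_circuit Cc) _ => g0 cg0.
    rewrite -addF2_eq0 -(f_mate g0) (jmp (mate g0)) //.
    by apply/hasP; exists c; rewrite // mateK cg0 eqxx.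
  rewrite cycle_all2rel => [|? ? ? /eqP-> //].
  by move/allrelP=> e /e{e}e /e/eqP.
have rep h0 : connect (@uadj U) (source h) (source h0) ->
    exists2 g, g \in c & f g = f h0.
  move=> con0; have : has (pred2 h0 (mate h0)) c.
    by rewrite has_count count_edge // -(euler_circuit_connect _ con0) eul_c.
  by case/hasP=> g cg /pred2P[]e; exists g; rewrite // e ?f_mate.
have [g cg <-] := rep h (connect0 _ _); have [g' cg' <-] := rep h' con.
exact: f_c.
Qed.

Lemma vert_halfedge v : exists h, source h == v.
Proof.
case: (set_0Vmem [set h | source h == v]) => [/eqP|[h]].
  2: by rewrite inE; exists h.
by rewrite -cards_eq0 deg4.
Qed.

(** A function constant on the curves splits uniquely into the integral of its jumps and a function
    constant on the components of [U]; [phi] is this bijection, [I] being a fixed choice of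
    integrals. *)
Lemma card_jump_equations theta : pairing theta ->
  (2 ^ n_comp [rel h h' | (h' == mate h) || (h' == theta h)] (halfedge U) =
   #|[set x : {ffun vert U -> 'F_2} |
       [forall v, jump_equation v (kind C v (transition_of theta v)) x]]| *
   2 ^ n_comp (@uadj U) (vert U))%N.
Proof.
move=> th; set e := [rel h h' | _]; set X := [set x | _].
have inv_sym (f : halfedge U -> halfedge U) : involutive f ->
    forall h h', (h' == f h) = (h == f h').
  by move=> fK h h'; rewrite eq_sym (can2_eq fK fK).
have sym_e : connect_sym e.
  apply: sym_connect_sym => h h' /=.
  by rewrite (inv_sym _ (@mateK U)) (inv_sym _ (pairingK th)).
rewrite -(card_invariant sym_e) -(card_invariant uadj_connect_sym) -cardsX.
set W := [set f | _]; set G := [set g | _].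
have inW (f : {ffun halfedge U -> 'F_2}) :
    reflect ((forall h, f (mate h) = f h) /\ (forall h, f (theta h) = f h))
      (f \in W).
  rewrite inE; apply: (iffP forallP) => [inv|[f_mate f_theta] h].
    by split=> h; have /forallP := inv h; [move/(_ (mate h)) | move/(_ (theta h))];
      rewrite /= eqxx ?orbT => /eqP.
  by apply/forallP=> h'; apply/implyP=> /orP[]/eqP->; rewrite ?f_mate ?f_theta.
have inG (g : {ffun vert U -> 'F_2}) :
    reflect (forall v w, uadj v w -> g v = g w) (g \in G).
  rewrite inE; apply: (iffP forallP) => [inv v w vw|inv v].
    by have /forallP/(_ w)/implyP/(_ vw)/eqP := inv v.
  by apply/forallP=> w; apply/implyP=> /inv->.
have [I /all_and2[I_mate I_jumps]] := fin_all_exists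
  (fun x : {ffun vert U -> 'F_2} => jumps_integral x).
pose phi (xg : {ffun vert U -> 'F_2} * {ffun vert U -> 'F_2}) :=
  [ffun h => I xg.1 h + xg.2 (source h)].
have phi_mate x g h : g \in G -> phi (x, g) (mate h) = phi (x, g) h.
  move=> /inG g_inv; rewrite !ffunE I_mate; congr (_ + _); apply/esym/g_inv.
  by apply/existsP; exists h; rewrite !eqxx.
have phi_jumps x g : jumps (phi (x, g)) x.
  move=> p h ph; rewrite !ffunE (follows_source ph) addrACA addF2xx addr0.
  exact: I_jumps.
rewrite -(card_in_imset (f := phi)) => [|[x g] [x' g']].
  apply: eq_card => f; apply/inW/imsetP => [[f_mate f_theta]|].
    have [x0 f_x0] := invariant_jumps th f_theta.
    pose x := finfun x0.
    have f_x : jumps f x by move=> p h ph; rewrite ffunE f_x0.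
    (* Removing the chosen integral from [f] leaves a function without jumps, which depends only on
       the component. *)
    pose k h := f h + I x h.
    have k_mate h : k (mate h) = k h by rewrite /k f_mate I_mate.
    have k_jumps : jumps k (fun=> 0).
      by move=> p h ph; rewrite /k addrACA f_x // I_jumps // addF2xx.
    have [out /= outP] := fin_all_exists vert_halfedge.
    exists (x, [ffun v => k (out v)]).
      rewrite inE /=; apply/andP; split.
        rewrite inE; apply/forallP=> v; rewrite (pairing_invariantP _ th f_mate f_x).
        by move=> h _.
      apply/inG => v w vw; rewrite !ffunE; apply: no_jump_connected => //.
      by rewrite !(eqP (outP _)) connect1.
    apply/ffunP=> h; rewrite !ffunE /= (no_jump_connected k_mate k_jumps (h' := h)).
      by rewrite /k addrC addF2Kr.
    by rewrite (eqP (outP _)) connect0.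
  case=> -[x g]; rewrite inE /= => /andP[Xx Gg] ->.
  split=> [h|]; first exact: phi_mate.
  move=> h; move: Xx; rewrite inE => /forallP/(_ (source h)).
  rewrite (pairing_invariantP _ th (fun h => phi_mate x g h Gg) (phi_jumps x g)).
  exact.
move=> _ _ eq_phi.
(* The vector is recovered from the jumps of its image under [phi]; the component function then
   follows by cancellation. *)
have eq_x : x = x'.
  apply/ffunP=> v; have [h1 [h2 [p1 [p2 fr]]]] := vertex_frame_exists v.
  have srcp1 : source p1 = v by apply/eqP; rewrite (frame_source fr) !inE eqxx !orbT.
  have p1h1 : follows C p1 h1 by rewrite (frame_follows fr) ?mem_head.
  by rewrite -srcp1 -(phi_jumps x g p1 h1) // eq_phi phi_jumps.
congr (_, _) => //; rewrite -eq_x in eq_phi; apply/ffunP=> v.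
have [h /eqP <-] := vert_halfedge v.
by have /ffunP/(_ h) := eq_phi; rewrite !ffunE => /addrI.
Qed.

End EulerSystem.

(** * Link diagrams *)

Section Diagram.
Variables (R : realType) (D : diagram R).
Implicit Types (x : 'I_(nclassical D)) (S T : {set 'I_(nclassical D)}).

Lemma negativeE x : negative x = ~~ positive x.
Proof.
have := transverse (d := D) x; rewrite /negative /positive -/(crossing_sign x).
by case: ltgtP.
Qed.

(** Both smoothings join the overpass to the underpass, hence the negated strand flag; the oriented
    one also joins incoming to outgoing, hence the flipped direction. *)
Definition smoothing_pairing (oriented : pred 'I_(nclassical D))
    (h : halfedge (universe D)) : halfedge (universe D) :=
  ((h.1.1, ~~ h.1.2), h.2 (+) oriented h.1.1).

Lemma smoothing_pairingP oriented : pairing (smoothing_pairing oriented).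
Proof.
split=> [[[x b] o]|[[x b] o]|[[x b] o]] //; rewrite /smoothing_pairing /=.
  by rewrite negbK addbK.
by rewrite !xpair_eqE; case: b; rewrite andbF.
Qed.

Lemma smoothing_transition oriented x :
  transition_of (smoothing_pairing oriented) (x : vert (universe D)) =
  if oriented x then oriented_smoothing x else unoriented_smoothing x.
Proof.
have mem4 (a b c d : bool * bool) (h : halfedge (universe D)) :
  (forall e, e \in [:: a; b; c; d]) ->
  (source h == x) = (h \in [:: ((x, a.1), a.2); ((x, b.1), b.2);
                               ((x, c.1), c.2); ((x, d.1), d.2)]).
  move: a b c d h => [a1 a2] [b1 b2] [c1 c2] [d1 d2] [[y i] j] all4.
  rewrite /= /dhalf_source /= !inE !xpair_eqE /= -!andbA.
  have := all4 (i, j); rewrite !inE !xpair_eqE /= => i_j.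
  by case: (y == x).
case: ifP => ox.
  rewrite (@transition_ofE _ _ _ (over_in x) (under_in x)
    (smoothing_pairingP oriented)).
    by rewrite /smoothing_pairing /= ox.
  move=> h; rewrite /smoothing_pairing /= ox.
  rewrite -(mem4 (true, false) (false, true) (false, false) (true, true)) //.
  by move=> [[] []].
rewrite (@transition_ofE _ _ _ (over_in x) (over_out x)
  (smoothing_pairingP oriented)).
  by rewrite /smoothing_pairing /= ox.
move=> h; rewrite /smoothing_pairing /= ox.
rewrite -(mem4 (true, false) (false, false) (true, true) (false, true)) //.
by move=> [[] []].
Qed.

Definition state_oriented S x := (x \in S) == positive x.

Lemma state_smoothingE S x : state_smoothing S x =
  transition_of (smoothing_pairing (state_oriented S)) (x : vert (universe D)).
Proof.
rewrite smoothing_transition /state_smoothing /state_oriented /A_smoothing /B_smoothing.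
by case: (x \in S); case: (positive x).
Qed.

(** Either a crossing provides a component with vertices, or every link component is a free loop. *)
Lemma ncomponents_gt0 : (0 < ncomponents (universe D))%N.
Proof.
rewrite addn_gt0; have [v _|n0] := pickP (fun _ : vert (universe D) => true).
  apply/orP; left; apply/card_gt0P; exists (fingraph.root (@uadj (universe D)) v).
  by rewrite inE andbT; apply: roots_root; apply: uadj_connect_sym.
apply/orP; right; apply/card_gt0P; exists (Ordinal (ncomp_gt0 D)).
by rewrite inE; apply/existsP=> -[p _]; have := n0 p.1.
Qed.

Variable C : seq (seq (halfedge (universe D))).
Hypothesis eulC : euler_system C.
Local Notation G := (interlacement_graph C).

(** Here [~: S] is the set of crossings with a B smoothing. Marks and loops conspire so that the
    deleted vertices are those smoothed along F, while at a kept vertex the diagonal entry is 0 for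
    N and 1 for I. *)
Lemma jump_equation_adjmx S x (u : {ffun 'I_(nclassical D) -> 'F_2}) :
  jump_equation C (x : vert (universe D))
    (kind C (x : vert (universe D)) (state_smoothing S x)) u =
  if x \in kept (G := G) (~: S)
  then \sum_w u w * (adjmx G + delta_mark (G := G) (~: S)) w x == 0
  else u x == 0.
Proof.
set M := adjmx G + _.
pose has_rx := has_r (crossing_mark C x).
pose b := ~~ positive x (+) (if x \in S then has_rx else ~~ has_rx).
have Mxx : M x x = b%:R.
  rewrite !mxE eqxx mulr1n /= negativeE /b /has_rx finset.in_setC.
  by case: positive; case: (x \in S); case: has_r; apply/eqP.
have sumE : \sum_w u w * M w x
          = \sum_w (interlaced C x w)%:R * u w + b%:R * u x.
  rewrite (bigD1 x) //= [in RHS](bigD1 x) //= interlaced_irr mul0r add0r addrC Mxx.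
  congr (_ + _); last exact: mulrC.
  apply: eq_bigr => w /negPf neq_wx; rewrite !mxE neq_wx mulr0n addr0 mulrC.
  by rewrite /= interlaced_sym.
(* Distinct kinds exclude the default case of [crossing_mark]. *)
have neq_k : kind C (x : vert (universe D)) (oriented_smoothing x) <>
             kind C (x : vert (universe D)) (unoriented_smoothing x).
  have -> : oriented_smoothing x =
      transition_of (smoothing_pairing predT) (x : vert (universe D)).
    by rewrite smoothing_transition.
  have -> : unoriented_smoothing x =
      transition_of (smoothing_pairing pred0) (x : vert (universe D)).
    by rewrite smoothing_transition.
  (* The two involutions differ in the direction flag at every half-edge. *)
  case/(kind_inj eulC (smoothing_pairingP _) (smoothing_pairingP _)) => h _ [].
  by case: (h.2).
rewrite sumE inE Mxx /state_smoothing /A_smoothing /B_smoothing.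
rewrite {Mxx sumE}/b {b}/has_rx {has_rx} /= /crossing_mark /jump_equation.
by case: positive; case: (x \in S); case: (kind _ _ (oriented_smoothing x)) neq_k;
  case: (kind _ _ (unoriented_smoothing x)) => //= _; rewrite ?mul0r ?mul1r ?addr0.
Qed.

(** The free loops cancel; the rest is compared as exponents of 2, the solutions of the jump
    equations being a supported kernel by [jump_equation_adjmx]. *)
Lemma state_curvesE S : state_curves S =
  (nullity (adjmx_at (G := G) (~: S)) + ncomponents (universe D))%N.
Proof.
rewrite /state_curves /ncomponents addnA; congr (_ + _)%N; apply/eqP.
rewrite -(eqn_exp2l _ _ (ltnSn 1)) expnD; apply/eqP.
have th := smoothing_pairingP (state_oriented S).
have -> : n_comp (state_adj S) (halfedge (universe D)) =
    n_comp [rel h h' | (h' == mate h)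
      || (h' == smoothing_pairing (state_oriented S) h)] (halfedge (universe D)).
  apply: eq_n_comp; apply: eq_connect => h h' /=.
  by rewrite /state_adj state_smoothingE mem_transition_of // eqxx.
rewrite (card_jump_equations eulC th); congr (_ * _)%N.
have := card_supported_kernel (adjmx G + delta_mark (G := G) (~: S))
  (kept (G := G) (~: S)).
rewrite card_Fp // => <-.
apply: eq_card => u; rewrite !inE; apply: eq_forallb => x.
by rewrite -jump_equation_adjmx state_smoothingE.
Qed.

End Diagram.

(** One bracket sums over the set of B smoothings, the other over its complement. Positivity of [k]
    keeps the subtractions [k - 1] and [g S - 1] from truncating. *)
Lemma sum_over_complements (A : comNzRingType) n (a b d : A) k
    (f g : {set 'I_n} -> nat) :
  (0 < k)%N -> (forall S, g S = f (~: S) + k)%N ->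
  d ^+ (k - 1) * \sum_(T : {set 'I_n}) a ^+ (n - #|T|) * b ^+ #|T| * d ^+ f T =
  \sum_(S : {set 'I_n}) a ^+ #|S| * b ^+ #|~: S| * d ^+ (g S - 1).
Proof.
move=> k_gt0 gE; rewrite mulr_sumr (reindex_inj (inv_inj (@finset.setCK _))).
apply: eq_bigr => S _; rewrite gE -addnBA // [in RHS]exprD [in RHS]mulrA [RHS]mulrC.
by rewrite -{1}(card_ord n) -cardsCs.
Qed.

Theorem theorem19 (R : realType) (D : diagram R)
    (C : seq (seq (halfedge (universe D)))) :
  euler_system C -> bracket (interlacement_graph C) = kauffman_bracket D.
Proof.
move=> eulC; apply: sum_over_complements; first exact: ncomponents_gt0.
exact: state_curvesE.
Qed.
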